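(* Let $d_{\text{in}}, B \ge 1$ and $1 \le k \le d_{\text{in}}$ be integers, let $w \in \mathbb{R}^{d_{\text{in}}}$ and $X \in \mathbb{R}^{d_{\text{in}} \times B}$, and let $f$, $Q$, $\mathcal{C}_k$, $\mathcal{C}_{\rm int}$ be as defined in the context. Let $m^*$ be a minimizer of $f$ over $\mathcal{C}_k$ and let $m^{\rm int}$ be a minimizer of $f$ over $\mathcal{C}_{\rm int}$. Let $\varepsilon \in \mathbb{R}$ and let $m^\varepsilon \in \mathcal{C}_k$ satisfy $\sum_{j} m^\varepsilon_j = k$ and $f(m^\varepsilon) \le f(m^* ) + \varepsilon$. Let $\widehat m \in \{0,1\}^{d_{\text{in}}}$ be the top-$k$ rounding of $m^\varepsilon$, i.e. $\widehat m_j = 1$ if $j \in \mathrm{Top}_k(m^\varepsilon)$ and $\widehat m_j = 0$ otherwise. Then, with $r := d_{\text{in}} - k$, $$f(\widehat m) - f(m^{\rm int}) \le \varepsilon + 2\,\lambda_{\max}(Q)\Big(\min\{k,r\} + \sqrt{2r\,\min\{k,r\}}\Big).$$ Moreover, if $2k \le d_{\text{in}}$ (sparsity 50% or more), so that $\min\{k,r\} = k$, then $$f(\widehat m) - f(m^{\rm int}) \le \varepsilon + 2\,\lambda_{\max}(Q)\Big(k + \sqrt{2\, d_{\text{in}}\, k}\Big).$$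
   Context: Here $w \in \mathbb{R}^{d_{\text{in}}}$ is a row of a weight matrix and $X \in \mathbb{R}^{d_{\text{in}} \times B}$ is a calibration input matrix. The symbol $\odot$ denotes the entrywise (Hadamard) product and $\mathbf{1}$ the all-ones vector. The objective function is, for $m \in \mathbb{R}^{d_{\text{in}}}$, $$f(m) := \|w^\top X - (w \odot m)^\top X\|_2^2 = (\mathbf{1} - m)^\top Q (\mathbf{1} - m),$$ where $Q := \mathrm{Diag}(w)\,(XX^\top)\,\mathrm{Diag}(w)$, which is symmetric positive semidefinite, and $\lambda_{\max}(Q)$ denotes its largest eigenvalue. The relaxed feasible set is $\mathcal{C}_k := \{m \in [0,1]^{d_{\text{in}}} : \|m\|_1 \le k\}$, and the combinatorial feasible set is $\mathcal{C}_{\rm int} := \{m \in \{0,1\}^{d_{\text{in}}} : \sum_j m_j = k\}$. For a vector $m \in \mathbb{R}^{d_{\text{in}}}$, $\mathrm{Top}_k(m)$ denotes a set of exactly $k$ indices corresponding to the $k$ largest entries of $m$ (ties broken arbitrarily). *)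

(* Defs.v *)
From HB Require Import structures.
From mathcomp Require Import all_boot all_order all_algebra.
From mathcomp Require Import boolp classical_sets reals.

Set Implicit Arguments.
Unset Strict Implicit.
Unset Printing Implicit Defensive.

Import Order.TTheory GRing.Theory Num.Theory.
Local Open Scope ring_scope.
Local Open Scope classical_set_scope.

Definition hadamard (R : realType) (m n : nat) (A B : 'M[R]_(m, n)) :
  'M[R]_(m, n) := map2_mx *%R A B.

(* The library norm on matrices over R is the max norm, so the Euclidean and
   l1 norms are written out. *)
Definition norm2 (R : realType) (n : nat) (v : 'rV[R]_n) : R :=
  Num.sqrt (\sum_(j < n) v 0 j ^+ 2).

Definition norm1 (R : realType) (d : nat) (m : 'cV[R]_d) : R :=
  \sum_(j < d) `|m j 0|.

Definition objective (R : realType) (d B : nat) (w : 'cV[R]_d)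
    (X : 'M[R]_(d, B)) (m : 'cV[R]_d) : R :=
  norm2 (w^T *m X - (hadamard w m)^T *m X) ^+ 2.

(* diag_mx expects a row vector, hence the transposes of w. *)
Definition Qmx (R : realType) (d B : nat) (w : 'cV[R]_d)
    (X : 'M[R]_(d, B)) : 'M[R]_d :=
  diag_mx w^T *m (X *m X^T) *m diag_mx w^T.

Lemma objectiveE (R : realType) (d B : nat) (w : 'cV[R]_d)
    (X : 'M[R]_(d, B)) (m : 'cV[R]_d) :
  objective w X m =
  ((const_mx 1 - m)^T *m Qmx w X *m (const_mx 1 - m)) 0 0.
Proof.
rewrite /objective /norm2 sqr_sqrtr; last by apply: sumr_ge0 => j _; apply: sqr_ge0.
have -> : w^T *m X - (hadamard w m)^T *m X =
    (const_mx 1 - m)^T *m diag_mx w^T *m X.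
  rewrite -mulmxBl; congr (_ *m _); apply/rowP => j.
  by rewrite mul_mx_diag !mxE mulrBl mul1r [m j 0 * _]mulrC.
set v := _ *m X.
have -> : (const_mx 1 - m)^T *m Qmx w X *m (const_mx 1 - m) = v *m v^T.
  by rewrite /v /Qmx 2![(_ *m _)^T]trmx_mul tr_diag_mx trmxK !mulmxA.
by rewrite mxE; apply: eq_bigr => j _; rewrite [v^T _ _]mxE expr2.
Qed.

(* The set of eigenvalues is finite, and it is nonempty when A is real
   symmetric of positive size; its supremum is then its maximum. *)
Definition lambda_max (R : realType) (d : nat) (A : 'M[R]_d) : R :=
  sup [set a : R | eigenvalue A a].

Definition relaxed_set (R : realType) (d k : nat) : set 'cV[R]_d :=
  [set m : 'cV[R]_d | (forall j, 0 <= m j 0 <= 1) /\ norm1 m <= k%:R].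

Definition integral_set (R : realType) (d k : nat) : set 'cV[R]_d :=
  [set m : 'cV[R]_d | (forall j, m j 0 = 0 \/ m j 0 = 1) /\ \sum_(j < d) m j 0 = k%:R].

Definition is_minimizer (R : realType) (T : Type) (f : T -> R) (C : set T)
    (x : T) : Prop :=
  C x /\ forall y, C y -> f x <= f y.

(* A relation rather than a function: any tie-breaking is allowed. *)
Definition is_top (R : realType) (d k : nat) (m : 'cV[R]_d)
    (T : {set 'I_d}) : Prop :=
  #|T| = k /\ forall i j, i \in T -> j \notin T -> m j 0 <= m i 0.

Definition indicator (R : realType) (d : nat) (T : {set 'I_d}) : 'cV[R]_d :=
  \col_(j < d) (if j \in T then 1 else 0).

(* Main.v *)
(** Write u = 1 - m^eps and x = m^eps - mhat. As f is the quadratic form of Q at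
    1 - m, f(mhat) - f(m^eps) = 2 x^T Q u + x^T Q x, while f(m^eps) - f(m^int)
    is at most eps because C_int is contained in C_k. Entries lie in [0, 1], so
    squares are at most absolute values: |u|^2 <= d - k, and |x|^2 <= 2 O, where
    O <= min(k, d - k) is the mass of m^eps outside T. The Rayleigh bound and
    Cauchy-Schwarz for the form Q conclude. *)
Require Import Defs.
From HB Require Import structures.
From mathcomp Require Import all_boot all_order all_algebra.
From mathcomp Require Import boolp classical_sets reals.
From mathcomp Require Import lra polyrcf complex.

Set Implicit Arguments.
Unset Strict Implicit.
Unset Printing Implicit Defensive.

Import Order.TTheory GRing.Theory Num.Theory.
Local Open Scope ring_scope.

(** * Rayleigh bound via the spectral theorem *)

Section HermitianForm.
Local Open Scope sesquilinear_scope.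

(** Diagonalization reads P A = D P, so row [i] of P is an eigenvector. *)
Lemma spectral_diag_eigenvalue (C : numClosedFieldType) n (A : 'M[C]_n) i :
  A \is normalmx -> eigenvalue A (spectral_diag A 0 i).
Proof.
move=> /orthomx_spectralP A_eq; set P := spectralmx A in A_eq *.
have Pu : P \in unitmx := spectral_unit A.
apply/eigenvalueP; exists (row i P).
  rewrite -row_mul {1}A_eq !mulmxA mulmxV // mul1mx.
  by apply/rowP => j; rewrite mul_diag_mx !mxE.
(* A zero row [i] would put [delta_mx 0 i] in the kernel of the invertible [P]. *)
apply: contraTneq Pu => Pi0; rewrite -row_free_unit -kermx_eq0.
have /sub_kermxP ker_i : delta_mx 0 i *m P = 0 :> 'rV_n by rewrite -rowE.
apply: contraTN isT => /eqP ker0; move: ker_i; rewrite ker0 submx0.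
by move=> /eqP/rowP/(_ i)/eqP; rewrite !mxE !eqxx oner_eq0.
Qed.

(** Passing to unitary coordinates preserves the norm and turns the form into a sum of spectral
    entries times squared moduli. *)
Lemma hermitian_form_le (C : numClosedFieldType) n (A : 'M[C]_n) (L : C) :
  A \is normalmx -> (forall i, spectral_diag A 0 i <= L) ->
  forall v : 'rV[C]_n,
    (v *m A *m v^t*) 0 0 <= L * (v *m v^t*) 0 0.
Proof.
move=> A_normal A_le v.
have /orthomx_spectralP A_eq := A_normal; set P := spectralmx A in A_eq *.
have P_unitary : P \is unitarymx := spectral_unitarymx A.
rewrite invmx_unitary // in A_eq.
set u := v *m P^t*.
have uE : u^t* = P *m v^t* by rewrite trmx_mul map_mxM trmxCK.
have -> : v *m A *m v^t* = u *m diag_mx (spectral_diag A) *m u^t*.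
  by rewrite {1}A_eq uE !mulmxA.
have -> : v *m v^t* = u *m u^t* by rewrite uE mulmxA mulmxKtV.
rewrite mul_mx_diag !mxE mulr_sumr; apply: ler_sum => i _.
by rewrite !mxE mulrAC mulrC -normCK ler_wpM2r ?exprn_ge0.
Qed.

End HermitianForm.

(** Roots of the characteristic polynomial lie within its Cauchy bound; this makes the [sup] in
    [lambda_max] dominate every eigenvalue. *)
Lemma eigenvalue_has_ubound (R : realType) n (A : 'M[R]_n) :
  has_ubound [set a : R | eigenvalue A a].
Proof.
exists (cauchy_bound (char_poly A)) => a /=; rewrite eigenvalue_root_char.
move=> /eqP /cauchy_boundP -/(_ (monic_neq0 (char_poly_monic A))).
by move/ltW; apply: le_trans; apply: ler_norm.
Qed.

(* The spectral theorem is only available over a closed field, so the form is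
   complexified; the eigenvalues of a real symmetric matrix remain real. *)
Lemma symmetric_form_le (R : realType) n (A : 'M[R]_n) (v : 'cV[R]_n) :
  A^T = A ->
  (v^T *m A *m v) 0 0 <= lambda_max A * \sum_(j < n) v j 0 ^+ 2.
Proof.
move=> A_sym; pose f := real_complex R; pose AC := map_mx f A.
have AC_real : AC \is a mxOver Num.real.
  by apply/mxOverP => i j; rewrite mxE; apply/complex_realP; eexists.
have AC_sym : AC \is symmetricmx.
  by apply/is_hermitianmxP; rewrite expr0 scale1r map_mx_id // /AC map_trmx A_sym.
have AC_herm := realsym_hermsym AC_sym AC_real.
have AC_normal := hermitian_normalmx AC_herm.
(* Each spectral entry is the image of a real [b], and [b] is an eigenvalue of [A] because the
   embedding [f] reflects eigenvalues. *)
have AC_le i : spectral_diag AC 0 i <= f (lambda_max A).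
  have /mxOverP/(_ 0 i)/complex_realP[b b_eq] :=
    hermitian_spectral_diag_real AC_herm.
  rewrite b_eq lecR; apply: ub_le_sup; first exact: eigenvalue_has_ubound.
  have := spectral_diag_eigenvalue i AC_normal.
  by rewrite b_eq (eigenvalue_map f).
have := hermitian_form_le AC_normal AC_le (map_mx f v^T).
have -> : ((map_mx f v^T)^t*)%sesqui = map_mx f v.
  by apply/matrixP => i j; rewrite !mxE; apply/CrealP/complex_realP; eexists.
rewrite -!map_mxM !mxE -rmorphM lecR.
by under [X in _ * X]eq_bigr do rewrite mxE -expr2.
Qed.

(** The Rayleigh bound is tested on the first basis vector, available since [0 < n]. *)
Lemma lambda_max_ge0 (R : realType) n (A : 'M[R]_n) :
  (0 < n)%N -> A^T = A -> (forall v : 'cV[R]_n, 0 <= (v^T *m A *m v) 0 0) ->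
  0 <= lambda_max A.
Proof.
case: n A => // n A _ A_sym A_ge0.
have := le_trans (A_ge0 _) (symmetric_form_le (delta_mx 0 0) A_sym).
rewrite pmulr_lge0 // (bigD1 ord0) //= mxE !eqxx expr1n.
by rewrite ltr_wpDr ?ltr01 // sumr_ge0 // => i _; rewrite sqr_ge0.
Qed.

(** * Expansion and Cauchy-Schwarz for quadratic forms *)

Lemma symmetric_formD (R : comPzRingType) n (A : 'M[R]_n) (x y : 'cV[R]_n) :
  A^T = A ->
  ((x + y)^T *m A *m (x + y)) 0 0 =
    (x^T *m A *m x) 0 0 + 2 * (x^T *m A *m y) 0 0 + (y^T *m A *m y) 0 0.
Proof.
move=> A_sym; have yx : (y^T *m A *m x) 0 0 = (x^T *m A *m y) 0 0.
  transitivity ((y^T *m A *m x)^T 0 0); first by rewrite [RHS]mxE.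
  by rewrite !trmx_mul trmxK A_sym mulmxA.
have entryD (M N : 'M[R]_1) : (M + N) 0 0 = M 0 0 + N 0 0 by rewrite mxE.
rewrite [(x + y)^T]raddfD /= !mulmxDl !mulmxDr !entryD yx.
by rewrite mulr_natl mulr2n !addrA.
Qed.

(** Cauchy-Schwarz for the form, with the Rayleigh bound applied to each vector; [a] and [b] are any
    bounds on the Euclidean norms. *)
Lemma symmetric_form_cross_le (R : realType) n (A : 'M[R]_n)
    (x y : 'cV[R]_n) (a b : R) :
  (0 < n)%N -> A^T = A -> (forall v : 'cV[R]_n, 0 <= (v^T *m A *m v) 0 0) ->
  0 <= a -> 0 <= b ->
  \sum_(j < n) x j 0 ^+ 2 <= a ^+ 2 -> \sum_(j < n) y j 0 ^+ 2 <= b ^+ 2 ->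
  (x^T *m A *m y) 0 0 <= lambda_max A * (a * b).
Proof.
move=> n_gt0 A_sym A_ge0 a_ge0 b_ge0 xa yb.
(* The final step cancels [a * b], so a zero bound, which forces a zero vector, is treated apart. *)
have null (v : 'cV[R]_n) : \sum_(j < n) v j 0 ^+ 2 <= 0 ^+ 2 -> v = 0.
  have sqr_v_ge0 j : true -> 0 <= v j 0 ^+ 2 by rewrite sqr_ge0.
  rewrite expr0n /= => v_le0; apply/colP => j; rewrite mxE; apply/eqP.
  rewrite -sqrf_eq0; apply/eqP; apply: (psumr_eq0P sqr_v_ge0) => //.
  by apply/le_anti; rewrite v_le0 sumr_ge0.
have [a0|a_neq0] := eqVneq a 0.
  by rewrite a0 in xa *; rewrite (null _ xa) trmx0 !mul0mx mxE mul0r mulr0.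
have [b0|b_neq0] := eqVneq b 0.
  by rewrite b0 in yb *; rewrite (null _ yb) mulmx0 mxE !mulr0.
have L_ge0 := lambda_max_ge0 n_gt0 A_sym A_ge0.
have qx : (x^T *m A *m x) 0 0 <= lambda_max A * a ^+ 2.
  by apply: le_trans (symmetric_form_le x A_sym) _; rewrite ler_wpM2l.
have qy : (y^T *m A *m y) 0 0 <= lambda_max A * b ^+ 2.
  by apply: le_trans (symmetric_form_le y A_sym) _; rewrite ler_wpM2l.
have formZ (c e : R) (u v : 'cV[R]_n) :
    ((c *: u)^T *m A *m (e *: v)) 0 0 = c * e * (u^T *m A *m v) 0 0.
  by rewrite [(c *: u)^T]linearZ /= -!scalemxAl -scalemxAr scalerA mxE.
(* Nonnegativity of the form at [b x - a y] gives [2 a b c <= b^2 p + a^2 q],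
   which is at most [2 a^2 b^2 lambda_max A]. *)
have := A_ge0 (b *: x + (- a) *: y).
rewrite symmetric_formD // !formZ.
move: qx qy; set p := (_ *m x) 0 0; set q := (_ *m y) 0 0; set c := (_ *m y) 0 0.
move=> qx qy form_ge0.
have ab_gt0 : 0 < a * b by rewrite mulr_gt0 ?lt_def ?a_neq0 ?b_neq0.
rewrite -(ler_pM2l ab_gt0).
have := ler_wpM2l (sqr_ge0 b) qx; have := ler_wpM2l (sqr_ge0 a) qy.
by nra.
Qed.

(** * Norm bounds for the rounding error and the complement *)

Lemma sum_indicator (R : realType) d (T : {set 'I_d}) (F G : 'I_d -> R) :
  \sum_(j < d) (if j \in T then F j else G j) =
    \sum_(j in T) F j + \sum_(j in ~: T) G j.
Proof.
rewrite (bigID (mem T)) /=; congr (_ + _).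
  by apply: eq_bigr => j ->.
by apply: eq_big => [j|j /negbTE ->] //; rewrite inE.
Qed.

(** As [T] has [k] elements and the total mass is [k], the mass missing on [T] equals the mass [O]
    outside it; each contributes one [O] to the factor 2. *)
Lemma rounding_dist_le (R : realType) d k (m : 'cV[R]_d) (T : {set 'I_d}) :
  (forall j, 0 <= m j 0 <= 1) -> \sum_(j < d) m j 0 = k%:R -> #|T| = k ->
  \sum_(j < d) (m - indicator R T) j 0 ^+ 2 <= 2 * (minn k (d - k))%:R.
Proof.
move=> m01 m_sum T_card.
set O := \sum_(j in ~: T) m j 0; set S := \sum_(j in T) m j 0.
have SO : S + O = k%:R.
  by rewrite -m_sum -sum_indicator; apply: eq_bigr => j _; case: ifP.
have S_ge0 : 0 <= S by apply: sumr_ge0 => j _; case/andP: (m01 j).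
have O_le : O <= (d - k)%:R.
  have := cardsC T; rewrite T_card card_ord => /(congr1 (subn^~ k)).
  rewrite addKn => <-; rewrite -sum1_card natr_sum.
  by apply: ler_sum => j _; case/andP: (m01 j).
have O_min : O <= (minn k (d - k))%:R.
  by case: leqP => _ //; rewrite -SO lerDr.
apply: le_trans (_ : (k%:R - S) + O <= _); last by rewrite -SO; lra.
have -> : k%:R - S = \sum_(j in T) (1 - m j 0).
  by rewrite sumrB sumr_const T_card.
rewrite -sum_indicator; apply: ler_sum => j _; rewrite !mxE.
by case/andP: (m01 j) => m_ge0 m_le1; case: ifP => _; nra.
Qed.

Lemma complement_norm_le (R : realType) d k (m : 'cV[R]_d) :
  (k <= d)%N -> (forall j, 0 <= m j 0 <= 1) -> \sum_(j < d) m j 0 = k%:R ->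
  \sum_(j < d) (const_mx 1 - m) j 0 ^+ 2 <= (d - k)%:R.
Proof.
move=> kd m01 m_sum.
have -> : (d - k)%:R = \sum_(j < d) (1 - m j 0).
  by rewrite sumrB m_sum sumr_const card_ord natrB.
apply: ler_sum => j _; rewrite !mxE.
by case/andP: (m01 j) => m_ge0 m_le1; nra.
Qed.

(** * The form of [Q] and the rounding guarantee *)

Lemma Qmx_sym (R : realType) d B (w : 'cV[R]_d) (X : 'M[R]_(d, B)) :
  (Qmx w X)^T = Qmx w X.
Proof. by rewrite /Qmx !trmx_mul trmxK tr_diag_mx !mulmxA. Qed.

(** The form at [v] is the objective at 1 - [v], a square. *)
Lemma Qmx_form_ge0 (R : realType) d B (w : 'cV[R]_d) (X : 'M[R]_(d, B))
    (v : 'cV[R]_d) :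
  0 <= (v^T *m Qmx w X *m v) 0 0.
Proof.
have := objectiveE w X (const_mx 1 - v); rewrite subKr => <-.
exact: sqr_ge0.
Qed.

Lemma relaxed_set_integral (R : realType) d k :
  (@integral_set R d k `<=` relaxed_set k)%classic.
Proof.
move=> m [m01 m_sum]; split=> [j|].
  by case: (m01 j) => ->; rewrite lexx ler01.
rewrite /norm1 -m_sum ler_sum // => j _.
by case: (m01 j) => ->; rewrite ?normr0 ?normr1.
Qed.

Theorem lemma2 (R : realType) (d B k : nat)
    (d_ge1 : (1 <= d)%N) (B_ge1 : (1 <= B)%N) (k_bounds : (1 <= k <= d)%N)
    (w : 'cV[R]_d) (X : 'M[R]_(d, B))
    (mstar mint meps : 'cV[R]_d) (eps : R) (T : {set 'I_d})
    (mstar_min : is_minimizer (objective w X) (relaxed_set k) mstar)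
    (mint_min : is_minimizer (objective w X) (integral_set k) mint)
    (meps_feasible : relaxed_set k meps)
    (meps_sum : \sum_(j < d) meps j 0 = k%:R)
    (meps_approx : objective w X meps <= objective w X mstar + eps)
    (T_top : is_top k meps T) :
  let mhat := indicator R T in
  let r := (d - k)%N in
  objective w X mhat - objective w X mint <=
    eps + 2 * lambda_max (Qmx w X) *
      ((minn k r)%:R + Num.sqrt (2 * r%:R * (minn k r)%:R))
  /\
  ((2 * k <= d)%N ->
    minn k r = k /\
    objective w X mhat - objective w X mint <=
      eps + 2 * lambda_max (Qmx w X) *
        (k%:R + Num.sqrt (2 * d%:R * k%:R))).
Proof.
move=> mhat r; have /andP[_ kd] := k_bounds.
have [meps01 _] := meps_feasible; have [T_card _] := T_top.
set Q := Qmx w X; set L := lambda_max Q; set s := minn k r.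
have L_ge0 : 0 <= L.
  exact: lambda_max_ge0 d_ge1 (Qmx_sym w X) (Qmx_form_ge0 w X).
pose x := meps - mhat; pose u := const_mx 1 - meps.
have x_le : \sum_(j < d) x j 0 ^+ 2 <= 2 * s%:R by exact: rounding_dist_le.
have u_le : \sum_(j < d) u j 0 ^+ 2 <= r%:R by exact: complement_norm_le.
have qx : (x^T *m Q *m x) 0 0 <= L * (2 * s%:R).
  apply: le_trans (symmetric_form_le x (Qmx_sym w X)) _.
  exact: ler_wpM2l.
have s2_ge0 : 0 <= 2 * s%:R :> R by rewrite mulr_ge0.
have cross : (x^T *m Q *m u) 0 0 <= L * Num.sqrt (2 * r%:R * s%:R).
  (* The root splits into the norm bounds sqrt(2s) for [x] and sqrt(r) for [u]. *)
  rewrite mulrAC sqrtrM //.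
  by apply: symmetric_form_cross_le; rewrite ?sqrtr_ge0 ?sqr_sqrtr //;
    [exact: Qmx_sym | exact: Qmx_form_ge0].
have rounding_gap : objective w X mhat - objective w X meps =
    2 * (x^T *m Q *m u) 0 0 + (x^T *m Q *m x) 0 0.
  have mhatE : const_mx 1 - mhat = x + u by rewrite [RHS]addrC addrA subrK.
  rewrite !objectiveE mhatE symmetric_formD ?Qmx_sym // -/u -/Q.
  by rewrite addrK addrC.
have mint_ge : objective w X mstar <= objective w X mint.
  by apply: mstar_min.2; apply: relaxed_set_integral; apply: mint_min.1.
have bound : objective w X mhat - objective w X mint <=
    eps + 2 * L * (s%:R + Num.sqrt (2 * r%:R * s%:R)) by nra.
split=> // k2d.
have sk : s = k by apply/minn_idPl; rewrite leq_subRL // addnn -mul2n.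
split=> //; apply: le_trans bound _.
(* Only [r <= d] under the root separates the two bounds. *)
rewrite sk lerD2l ler_wpM2l ?mulr_ge0 // lerD2l ler_wsqrtr //.
by rewrite ler_wpM2r // ler_wpM2l // ler_nat leq_subr.
Qed.
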